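(* Let $\mathcal X$ be a real linear space, $\mathcal X_0:=\mathcal X\setminus\{0\}$, $\mathcal Y$ a real Banach space, and $r,s,t$ positive integers. Let $f,g,h:\mathcal X\to\mathcal Y$ be mappings with $f(0)=g(0)=h(0)=0$ for which there exists a function $\varphi:\mathcal X_0\times\mathcal X_0\to[0,\infty)$ such that, for all $x,y\in\mathcal X_0$, $$\begin{aligned}\widetilde\varphi(x,y):=\frac23\sum_{n=0}^\infty3^{-n}\Big[&\varphi\!\left(\tfrac{3^{n+1}}2x,\tfrac{-3^n}2y\right)+\tfrac12\varphi\!\left(\tfrac{3^{n+1}}2x,\tfrac{3^{n+1}}2y\right)+\tfrac12\varphi\!\left(\tfrac{3^{n+1}}2x,\tfrac{-3^{n+1}}2y\right)\\&+\tfrac12\varphi\!\left(\tfrac{3^n}2x,\tfrac{3^n}2y\right)+\tfrac12\varphi\!\left(\tfrac{3^n}2x,\tfrac{-3^n}2y\right)\Big]<\infty\end{aligned}$$ and $$\left\|r f\!\left(\frac{sx+ty}{r}\right)-s\,g(x)-t\,h(y)\right\|\le\varphi\!\left(x,\tfrac ts y\right).$$ If $h$ is an odd mapping, then there exists a unique additive mapping $A:\mathcal X\to\mathcal Y$ such that, for all $x\in\mathcal X_0$, $$\|f(x)-A(x)\|\le\frac1r\,\widetilde\varphi\!\left(\tfrac rs x,\tfrac rs x\right),$$ $$\|g(x)-A(x)\|\le\frac1{2s}\varphi(x,x)+\frac1{2s}\varphi(x,-x)+\frac1{2s}\widetilde\varphi(2x,2x),$$ $$\|h(x)-A(x)\|\le\frac1{2t}\varphi\!\left(\tfrac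 ts x,\tfrac ts x\right)+\frac1{2t}\varphi\!\left(\tfrac ts x,\tfrac{-t}s x\right)+\frac1{2t}\widetilde\varphi\!\left(\tfrac{2t}s x,\tfrac{2t}s x\right).$$
   Context: A map $A$ between linear spaces is additive if $A(x+y)=A(x)+A(y)$ for all $x,y$; $h$ is odd if $h(-x)=-h(x)$ for all $x$. *)

(* Defs.v *)
From mathcomp Require Import all_boot all_order all_algebra.
From mathcomp Require Import all_classical all_reals all_analysis.

Set Implicit Arguments.
Unset Strict Implicit.
Unset Printing Implicit Defensive.

Import Order.TTheory GRing.Theory Num.Theory.
Import numFieldNormedType.Exports.

Local Open Scope ring_scope.

(* The control function on (X \ {0})^2 is represented by a total function
   phi : X -> X -> R; statements using it constrain and evaluate phi only at
   pairs of nonzero vectors (for x, y != 0, so are all arguments of phi below).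
   The sum is taken in the extended reals, so that its convergence, for phi
   nonnegative, reads [phi_tilde phi x y < +oo]. *)
Definition phi_tilde (R : realType) (X : lmodType R) (phi : X -> X -> R)
    (x y : X) : \bar R :=
  ((2 / 3)%:E * \sum_(0 <= n <oo)
    (3 ^- n *
      (phi ((3 ^+ n.+1 / 2) *: x) ((- (3 ^+ n) / 2) *: y)
       + 2^-1 * phi ((3 ^+ n.+1 / 2) *: x) ((3 ^+ n.+1 / 2) *: y)
       + 2^-1 * phi ((3 ^+ n.+1 / 2) *: x) ((- (3 ^+ n.+1) / 2) *: y)
       + 2^-1 * phi ((3 ^+ n / 2) *: x) ((3 ^+ n / 2) *: y)
       + 2^-1 * phi ((3 ^+ n / 2) *: x) ((- (3 ^+ n) / 2) *: y)))%:E)%E.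

(* Main.v *)
(* Rescaling to F z = r f(sz/r), G = s g, H z = t h(sz/t) turns the hypothesis
   into the Pexider inequality |F(x+y) - G x - H y| <= phi(x,y).  Taking
   y = x and y = -x, with H odd and F 0 = 0, bounds F(2x) - 2 G x and
   F(2x) - 2 H x by phi(x,x) + phi(x,-x); at 3x/2 and x/2, together with
   x = 3x/2 - x/2, this bounds F x - F(3x)/3 by the first term of phi_tilde.
   Hence 3^-n F(3^n x) converges to some A x within phi_tilde(x,x) of F x, and
   the rescaled G and H both converge to B x = A(2x)/2.  So
   A(x+y) = B x + B y for nonzero x and y, with B odd; together with
   A(3x) = 3 A x, the decompositions x = 2x - x and 3x = 2x + x give B = A,
   i.e. A is additive.  Uniqueness holds because 3^-n phi_tilde(3^n x, 3^n x)
   is a tail of a convergent series, which forces any candidate to be the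
   limit of 3^-n F(3^n x). *)

Require Import Defs.
From mathcomp Require Import all_boot all_order all_algebra.
From mathcomp Require Import all_classical all_reals all_analysis.
From mathcomp Require Import ring lra.

Set Implicit Arguments.
Unset Strict Implicit.
Unset Printing Implicit Defensive.

Import Order.TTheory GRing.Theory Num.Theory.
Import numFieldNormedType.Exports.

Local Open Scope ring_scope.
Local Open Scope classical_set_scope.

(** * Limits of sequences in normed spaces *)

Lemma cvg_dist_squeeze (R : realType) (Y : normedModType R) (a b : nat -> Y)
    (e : nat -> R) (l : Y) :
  (forall n, `|a n - b n| <= e n) -> e @ \oo --> 0 -> b @ \oo --> l ->
  a @ \oo --> l.
Proof.
move=> abe e0 bl; rewrite -[l]add0r.
have -> : a = (fun n => (a n - b n) + b n) by apply/funext => n; rewrite subrK.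
apply: cvgD => //; apply: norm_cvg0.
apply: (@squeeze_cvgr _ _ _ _ (cst 0) e) => //; last exact: cvg_cst.
by apply: nearW => n; rewrite normr_ge0 abe.
Qed.

(** The telescoping series of [a] is dominated by the summable [u], so it converges by completeness
    of [Y]. The bound passes to the limit from the triangle inequality on partial sums. *)
Lemma cvg_summable_steps (R : realType) (Y : completeNormedModType R)
    (a : nat -> Y) (u : nat -> R) :
  (forall n, `|a n - a n.+1| <= u n) ->
  (\sum_(0 <= n <oo) (u n)%:E < +oo)%E ->
  cvgn a /\ (`|a 0%N - limn a|%:E <= \sum_(0 <= n <oo) (u n)%:E)%E.
Proof.
move=> au su.
have u0 n : 0 <= u n by exact: le_trans (au n).
have cu := nnseries_is_cvg u0 su.
have tele_cvg : cvgn (series (telescope a)).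
  apply: normed_cvg; apply: (series_le_cvg _ u0 _ cu) => n //=.
  by rewrite /telescope distrC.
have ca : cvgn a.
  have -> : a = (fun n => a 0%N + series (telescope a) n).
    by apply/funext => n; rewrite -eq_sum_telescope.
  by apply: is_cvgD => //; exact: is_cvg_cst.
split=> //.
have partial n : `|a 0%N - a n| <= series u n.
  elim: n => [|n IH]; first by rewrite subrr normr0 /series /= big_geq.
  rewrite (le_trans (ler_distD (a n) _ _))// seriesSr.
  exact: lerD.
have su_fin : (\sum_(0 <= n <oo) (u n)%:E)%E \is a fin_num.
  by rewrite ge0_fin_numE//; apply: nneseries_ge0 => n _ _; rewrite lee_fin.
rewrite -(fineK su_fin) lee_fin.
have -> : `|a 0%N - limn a| = limn (fun n => `|a 0%N - a n|).
  apply/esym/cvg_lim => //; apply: cvg_norm.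
  by apply: cvgB => //; exact: cvg_cst.
apply: limr_le.
  by apply: is_cvg_norm; apply: is_cvgB => //; exact: is_cvg_cst.
apply: nearW => n; apply: le_trans (partial n) _.
rewrite -lee_fin fineK// /series /= -sumEFin.
by apply: nneseries_lim_ge => k _ _; rewrite lee_fin.
Qed.

(** * The control series and its scaling by powers of 3 *)

(** The bracket of [phi_tilde] at n = 0; the n-th one is this bracket at [3 ^+ n *: x] and
    [3 ^+ n *: y]. Signs stand outside the scalars, ready for the oddness of [H]. *)
Definition phi_bracket (R : realType) (X : lmodType R) (phi : X -> X -> R)
    (u v : X) : R :=
  phi ((3 / 2) *: u) (- (2^-1 *: v))
  + 2^-1 * phi ((3 / 2) *: u) ((3 / 2) *: v)
  + 2^-1 * phi ((3 / 2) *: u) (- ((3 / 2) *: v))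
  + 2^-1 * phi (2^-1 *: u) (2^-1 *: v)
  + 2^-1 * phi (2^-1 *: u) (- (2^-1 *: v)).

Lemma expr3Z_neq0 (R : realType) (X : lmodType R) (x : X) n :
  x != 0 -> 3 ^+ n *: x != 0.
Proof. by move=> x0; rewrite scaler_eq0 negb_or x0 expf_neq0// pnatr_eq0. Qed.

Lemma phi_bracket_expr3 (R : realType) (X : lmodType R) (phi : X -> X -> R)
    (x y : X) n :
  phi ((3 ^+ n.+1 / 2) *: x) ((- (3 ^+ n) / 2) *: y)
  + 2^-1 * phi ((3 ^+ n.+1 / 2) *: x) ((3 ^+ n.+1 / 2) *: y)
  + 2^-1 * phi ((3 ^+ n.+1 / 2) *: x) ((- (3 ^+ n.+1) / 2) *: y)
  + 2^-1 * phi ((3 ^+ n / 2) *: x) ((3 ^+ n / 2) *: y)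
  + 2^-1 * phi ((3 ^+ n / 2) *: x) ((- (3 ^+ n) / 2) *: y)
  = phi_bracket phi (3 ^+ n *: x) (3 ^+ n *: y).
Proof.
rewrite /phi_bracket !scalerA exprS; set c := 3 ^+ n.
by rewrite !mulNr !scaleNr (mulrAC 3 c) (mulrC c).
Qed.

Lemma phi_bracket_ge0 (R : realType) (X : lmodType R) (phi : X -> X -> R)
    (phi_ge0 : forall x y : X, x != 0 -> y != 0 -> 0 <= phi x y) (x y : X) :
  x != 0 -> y != 0 -> 0 <= phi_bracket phi x y.
Proof.
move=> x0 y0.
by rewrite /phi_bracket !addr_ge0 ?mulr_ge0 ?invr_ge0// phi_ge0 ?oppr_eq0
  ?scaler_eq0 ?negb_or ?x0 ?y0 ?andbT ?invr_eq0 ?mulf_neq0 ?invr_neq0 ?pnatr_eq0.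
Qed.

Lemma phi_tildeE (R : realType) (X : lmodType R) (phi : X -> X -> R)
    (phi_ge0 : forall x y : X, x != 0 -> y != 0 -> 0 <= phi x y) (x y : X) :
  x != 0 -> y != 0 ->
  phi_tilde phi x y = (\sum_(0 <= n <oo)
    (2 / 3 * (3 ^- n * phi_bracket phi (3 ^+ n *: x) (3 ^+ n *: y)))%:E)%E.
Proof.
move=> x0 y0; rewrite /phi_tilde -nneseriesZl; last first.
  move=> n _; rewrite lee_fin mulr_ge0 ?invr_ge0 ?exprn_ge0//.
  set b := (b in 0 <= b).
  suff -> : b = phi_bracket phi (3 ^+ n *: x) (3 ^+ n *: y).
    by apply: phi_bracket_ge0 => //; exact: expr3Z_neq0.
  exact: phi_bracket_expr3.
apply: eq_eseriesr => n _; rewrite -EFinM; congr (_ * (_ * _))%:E.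
exact: phi_bracket_expr3.
Qed.

Lemma phi_tilde_ge0 (R : realType) (X : lmodType R) (phi : X -> X -> R)
    (phi_ge0 : forall x y : X, x != 0 -> y != 0 -> 0 <= phi x y) (x y : X) :
  x != 0 -> y != 0 -> (0 <= phi_tilde phi x y)%E.
Proof.
move=> x0 y0; rewrite phi_tildeE//; apply: nneseries_ge0 => n _ _.
by rewrite lee_fin !mulr_ge0 ?invr_ge0 ?exprn_ge0// phi_bracket_ge0//
  expr3Z_neq0.
Qed.

(** Scaling both arguments by 3^m and the value by 3^-m shifts the summation index by m, which
    leaves the tail from m of a convergent series. *)
Lemma phi_tilde_tail_cvg (R : realType) (X : lmodType R) (phi : X -> X -> R)
    (phi_ge0 : forall x y : X, x != 0 -> y != 0 -> 0 <= phi x y) (x y : X) :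
  x != 0 -> y != 0 -> (phi_tilde phi x y < +oo)%E ->
  ((3 ^- m)%:E * phi_tilde phi (3 ^+ m *: x) (3 ^+ m *: y))%E @[m --> \oo]
    --> (0 : \bar R)%E.
Proof.
move=> x0 y0; rewrite phi_tildeE//.
pose u n :=
  (2 / 3 * (3 ^- n * phi_bracket phi (3 ^+ n *: x) (3 ^+ n *: y)))%:E.
have u0 n : (0 <= u n)%E.
  rewrite lee_fin !mulr_ge0 ?invr_ge0 ?exprn_ge0// phi_bracket_ge0//;
    exact: expr3Z_neq0.
move=> su.
rewrite [X in X @ _ --> _](_ : _ = fun m => (\sum_(m <= k <oo) u k)%E).
  exact: nneseries_tail_cvg su (fun k _ => u0 k).
apply/funext => m.
rewrite -nneseries_addn// phi_tildeE//; try exact: expr3Z_neq0.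
rewrite -nneseriesZl; last first.
  move=> n _; rewrite lee_fin !mulr_ge0 ?invr_ge0 ?exprn_ge0//.
  by apply: phi_bracket_ge0 => //; do 2 apply: expr3Z_neq0.
apply: eq_eseriesr => n _; rewrite /u -EFinM !scalerA -exprD.
by congr EFin; rewrite exprD invfM; ring.
Qed.

(** The terms of the convergent series [phi_tilde phi (2 *: x) (2 *: y)] tend to 0, and the fourth
    summand of its n-th bracket is half of phi(3^n x, 3^n y). *)
Lemma phi_expr3_cvg0 (R : realType) (X : lmodType R) (phi : X -> X -> R)
    (phi_ge0 : forall x y : X, x != 0 -> y != 0 -> 0 <= phi x y) (x y : X) :
  (forall x y : X, x != 0 -> y != 0 -> (phi_tilde phi x y < +oo)%E) ->
  x != 0 -> y != 0 ->
  3 ^- n * phi (3 ^+ n *: x) (3 ^+ n *: y) @[n --> \oo] --> (0 : R).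
Proof.
move=> phi_fin x0 y0.
have x20 : 2 *: x != 0 by rewrite scaler_eq0 negb_or pnatr_eq0.
have y20 : 2 *: y != 0 by rewrite scaler_eq0 negb_or pnatr_eq0.
have := phi_fin _ _ x20 y20; rewrite phi_tildeE//.
pose u n := 2 / 3 * (3 ^- n *
  phi_bracket phi (3 ^+ n *: (2 *: x)) (3 ^+ n *: (2 *: y))).
have u0 n : 0 <= u n.
  by rewrite !mulr_ge0 ?invr_ge0 ?exprn_ge0// phi_bracket_ge0// expr3Z_neq0.
move=> su.
have u_cvg0 : u @ \oo --> 0 := cvg_series_cvg_0 (nnseries_is_cvg u0 su).
(* The factor 3 undoes the weight 2/3 * 1/2 with which phi(3^n x, 3^n y) enters [u n]. *)
apply: (@squeeze_cvgr _ _ _ _ (cst 0) (3 *: u)); first last.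
- by rewrite -[0](scaler0 _ 3); apply: cvgZl_tmp.
- exact: cvg_cst.
apply: nearW => n /=.
have nz (z : X) : z != 0 -> 3 ^+ n *: z != 0 by exact: expr3Z_neq0.
rewrite mulr_ge0 ?invr_ge0 ?exprn_ge0 ?phi_ge0 ?nz//=.
have -> : (3 *: u) n = 3 ^- n * (2 *
    phi_bracket phi (3 ^+ n *: (2 *: x)) (3 ^+ n *: (2 *: y))).
  by rewrite -[LHS]/(3 * u n) /u; field; rewrite expf_neq0// pnatr_eq0.
rewrite ler_wpM2l ?invr_ge0 ?exprn_ge0//.
rewrite [3 ^+ n *: (2 *: x)]scalerA [3 ^+ n *: (2 *: y)]scalerA.
rewrite ![3 ^+ n * 2]mulrC -!scalerA /phi_bracket.
set p := 3 ^+ n *: x; set q := 3 ^+ n *: y.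
have half z : 2^-1 *: (2 *: z) = z :> X by rewrite scalerA mulVf ?pnatr_eq0 ?scale1r.
have three z : (3 / 2) *: (2 *: z) = 3 *: z :> X.
  by rewrite scalerA; congr (_ *: _); field.
rewrite !half !three.
have p0 : p != 0 by exact: nz.
have q0 : q != 0 by exact: nz.
have p30 : 3 *: p != 0 by rewrite scaler_eq0 negb_or pnatr_eq0.
have q30 : 3 *: q != 0 by rewrite scaler_eq0 negb_or pnatr_eq0.
have := phi_ge0 _ _ p30 q30.
have : 0 <= phi (3 *: p) (- q) by rewrite phi_ge0 ?oppr_eq0.
have : 0 <= phi (3 *: p) (- (3 *: q)) by rewrite phi_ge0 ?oppr_eq0.
have : 0 <= phi p (- q) by rewrite phi_ge0 ?oppr_eq0.
by lra.
Qed.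

(** * Estimates from the Pexider inequality *)

(** Adding the expressions at (x, x) and (x, -x) cancels [H x]. *)
Lemma pexider_double_l (R : realType) (X : lmodType R) (Y : normedModType R)
    (F G H : X -> Y) (phi : X -> X -> R) (F0 : F 0 = 0)
    (H_odd : forall x, H (- x) = - H x)
    (FGH : forall x y, x != 0 -> y != 0 ->
       `|F (x + y) - G x - H y| <= phi x y) (x : X) :
  x != 0 -> `|F (2 *: x) - 2 *: G x| <= phi x x + phi x (- x).
Proof.
move=> x0; have Nx0 : - x != 0 by rewrite oppr_eq0.
have := lerD (FGH _ _ x0 x0) (FGH _ _ x0 Nx0).
rewrite H_odd subrr F0 sub0r opprK; apply: le_trans.
apply: le_trans (ler_normD _ _).
by rewrite (addrC (- G x)) addrA subrK !scaler_nat !mulr2n opprD addrA.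
Qed.

(** Subtracting the expressions at (x, x) and (x, -x) cancels [G x]. *)
Lemma pexider_double_r (R : realType) (X : lmodType R) (Y : normedModType R)
    (F G H : X -> Y) (phi : X -> X -> R) (F0 : F 0 = 0)
    (H_odd : forall x, H (- x) = - H x)
    (FGH : forall x y, x != 0 -> y != 0 ->
       `|F (x + y) - G x - H y| <= phi x y) (x : X) :
  x != 0 -> `|F (2 *: x) - 2 *: H x| <= phi x x + phi x (- x).
Proof.
move=> x0; have Nx0 : - x != 0 by rewrite oppr_eq0.
have := lerD (FGH _ _ x0 x0) (FGH _ _ x0 Nx0).
rewrite H_odd subrr F0 sub0r opprK (addrC (- G x)) (distrC (H x)).
apply: le_trans; apply: le_trans (ler_normD _ _).
rewrite (addrAC _ (- G x)) addrA subrK.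
by rewrite !scaler_nat !mulr2n opprD addrA.
Qed.

Lemma pexider_triple (R : realType) (X : lmodType R) (Y : normedModType R)
    (F G H : X -> Y) (phi : X -> X -> R) (F0 : F 0 = 0)
    (H_odd : forall x, H (- x) = - H x)
    (FGH : forall x y, x != 0 -> y != 0 ->
       `|F (x + y) - G x - H y| <= phi x y) (x : X) :
  x != 0 -> `|F x - 3^-1 *: F (3 *: x)| <= 2 / 3 * phi_bracket phi x x.
Proof.
(* Chosen so that 2p = 3x, 2q = x and p - q = x: doubling at [p] and [q] and the inequality at (p,
   -q) then involve [F] only at x and 3x. *)
move=> x0; pose p := (3 / 2) *: x; pose q := 2^-1 *: x.
have p0 : p != 0.
  by rewrite scaler_eq0 negb_or x0 mulf_neq0// ?invr_eq0 pnatr_eq0.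
have q0 : q != 0 by rewrite scaler_eq0 negb_or x0 invr_eq0 pnatr_eq0.
have Nq0 : - q != 0 by rewrite oppr_eq0.
have p2 : 2 *: p = 3 *: x by rewrite scalerA; congr (_ *: _); field.
have q2 : 2 *: q = x by rewrite scalerA mulfV ?scale1r ?pnatr_eq0.
have pBq : p - q = x.
  by rewrite -scalerBl -[RHS]scale1r; congr (_ *: _); field.
have dp := pexider_double_l F0 H_odd FGH p0; rewrite p2 distrC in dp.
have dq := pexider_double_r F0 H_odd FGH q0; rewrite q2 in dq.
have dpq := FGH _ _ p0 Nq0; rewrite pBq H_odd opprK in dpq.
suff H3 : `|3 *: (F x - 3^-1 *: F (3 *: x))| <=
    2 * phi p (- q) + (phi p p + phi p (- p)) + (phi q q + phi q (- q)).
  rewrite normrZ ger0_norm// in H3.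
  rewrite /phi_bracket -/p -/q; lra.
(* [G p] and [H q] cancel between the three groups, each of which is bounded by one of the estimates
   above. *)
have -> : 3 *: (F x - 3^-1 *: F (3 *: x)) =
    2 *: (F x - G p + H q) + (2 *: G p - F (3 *: x)) + (F x - 2 *: H q).
  rewrite scalerBr scalerA mulfV ?pnatr_eq0// scale1r.
  move: (F (3 *: x)) => a.
  have -> : 3 *: F x = 2 *: F x + F x.
    by rewrite -[X in _ + X]scale1r -scalerDl; congr (_ *: _); ring.
  rewrite scalerDr scalerBr; move: (2 *: F x) (2 *: G p) (2 *: H q) => b c d.
  rewrite (addrAC b (- c)) (addrA _ c) subrK.
  by rewrite (addrAC b d) (addrC (F x)) addrA addrK addrAC.
apply: le_trans (ler_normD _ _) _; rewrite lerD//.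
apply: le_trans (ler_normD _ _) _; rewrite lerD//.
by rewrite normrZ ger0_norm// ler_wpM2l.
Qed.

(** * Additivity of the limit map *)

Lemma pexider_limit_additive (R : realType) (X : lmodType R)
    (Y : normedModType R) (F G H A : X -> Y) (phi : X -> X -> R) (F0 : F 0 = 0)
    (H_odd : forall x, H (- x) = - H x)
    (FGH : forall x y, x != 0 -> y != 0 ->
       `|F (x + y) - G x - H y| <= phi x y)
    (phi_cvg0 : forall x y, x != 0 -> y != 0 ->
       3 ^- n * phi (3 ^+ n *: x) (3 ^+ n *: y) @[n --> \oo] --> (0 : R))
    (FA : forall x, 3 ^- n *: F (3 ^+ n *: x) @[n --> \oo] --> A x) (x y : X) :
  A (x + y) = A x + A y.
Proof.
have A0 : A 0 = 0.
  apply: (cvg_unique (@norm_hausdorff _ _) (FA 0)).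
  rewrite /= [X in X @ _ --> _](_ : _ = cst 0); first exact: cvg_cst.
  by apply/funext => n; rewrite /= scaler0 F0 scaler0.
(* The sequence at 3z is 3 times the sequence at z shifted by one index. *)
have A3 z : A (3 *: z) = 3 *: A z.
  have := FA z; rewrite -cvg_shiftS => /(cvgZl_tmp (k := 3)) FAz.
  apply: (cvg_unique (@norm_hausdorff _ _) (FA _)).
  move: FAz; apply: cvg_trans; apply: near_eq_cvg; apply: nearW => n /=.
  by rewrite !scalerA -exprSr exprS invfM mulrA mulfV ?pnatr_eq0// mul1r.
(* The common limit of the rescaled [G] and [H]: by the doubling estimates both are close to half of
   [F] at the doubled argument, with an error that vanishes after division by 3^n. *)
pose B z := 2^-1 *: A (2 *: z).
have double_cvg (K : X -> Y) :
    (forall z, z != 0 ->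
       `|F (2 *: z) - 2 *: K z| <= phi z z + phi z (- z)) ->
    forall z, z != 0 -> 3 ^- n *: K (3 ^+ n *: z) @[n --> \oo] --> B z.
  move=> FK z z0; have Nz0 : - z != 0 by rewrite oppr_eq0.
  pose e n := 2^-1 * (3 ^- n * phi (3 ^+ n *: z) (3 ^+ n *: z)
                      + 3 ^- n * phi (3 ^+ n *: z) (3 ^+ n *: - z)).
  apply: (@cvg_dist_squeeze _ _ _
      (fun n => 2^-1 *: (3 ^- n *: F (3 ^+ n *: (2 *: z)))) e).
  - move=> n; rewrite /e distrC -mulrDr scalerN.
    have -> : 2^-1 *: (3 ^- n *: F (3 ^+ n *: (2 *: z)))
        - 3 ^- n *: K (3 ^+ n *: z) =
        2^-1 *: (3 ^- n *: (F (2 *: (3 ^+ n *: z)) - 2 *: K (3 ^+ n *: z))).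
      rewrite !scalerBr; congr (_ *: (_ *: F _) - _).
        by rewrite !scalerA mulrC.
      by rewrite !scalerA mulrAC mulVf ?pnatr_eq0// mul1r.
    rewrite !normrZ !ger0_norm ?invr_ge0 ?exprn_ge0//.
    by rewrite !ler_wpM2l ?invr_ge0 ?exprn_ge0// FK// expr3Z_neq0.
  - rewrite -[0](mulr0 2^-1) -[X in _ * X](addr0 0).
    by apply: cvgMl_tmp; apply: cvgD; exact: phi_cvg0.
  - by apply: cvgZl_tmp; exact: FA.
have GB := double_cvg G (pexider_double_l F0 H_odd FGH).
have HB := double_cvg H (pexider_double_r F0 H_odd FGH).
have AB u v : u != 0 -> v != 0 -> A (u + v) = B u + B v.
  move=> u0 v0; apply: (cvg_unique (@norm_hausdorff _ _) (FA _)).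
  apply: (cvg_dist_squeeze _ (phi_cvg0 u v u0 v0) (cvgD (GB _ u0) (HB _ v0))).
  move=> n /=; rewrite scalerDr opprD addrA -!scalerBr normrZ.
  rewrite ger0_norm ?invr_ge0 ?exprn_ge0// ler_wpM2l ?invr_ge0 ?exprn_ge0//.
  by apply: FGH; exact: expr3Z_neq0.
have two0 (z : X) : z != 0 -> 2 *: z != 0.
  by move=> z0; rewrite scaler_eq0 negb_or pnatr_eq0.
(* [AB] at (z, -z) makes [B] odd. Then A z = B(2z) - B z and A(3z) = B(2z) + B z, so 3 A z = A z + 2
   B z. *)
have B_eqA z : z != 0 -> B z = A z.
  move=> z0; have Nz0 : - z != 0 by rewrite oppr_eq0.
  have BN : B (- z) = - B z.
    by apply/eqP; rewrite -addr_eq0 addrC -AB// subrr A0.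
  have A1 : A z = B (2 *: z) - B z.
    by rewrite -BN -AB ?two0// scaler_nat mulr2n addrK.
  have : A (3 *: z) = B (2 *: z) + B z.
    by rewrite -AB ?two0// !scaler_nat -mulrSr.
  have -> : B (2 *: z) = A z + B z by rewrite A1 subrK.
  have natZ (v : Y) : v + v = 2 *: v by rewrite scaler_nat mulr2n.
  have two_neq0 : (2 : R) != 0 by rewrite pnatr_eq0.
  rewrite A3 scaler_nat mulrS mulr2n -addrA => /addrI.
  by rewrite !natZ => /(scalerI two_neq0).
(* [AB] covers nonzero vectors only; a zero argument is settled by A 0 = 0. *)
have [->|x0] := eqVneq x 0; first by rewrite A0 !add0r.
have [->|y0] := eqVneq y 0; first by rewrite A0 !addr0.
by rewrite AB// !B_eqA.
Qed.

(** * Consequences of additivity *)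

Lemma additive_natZ (R : realType) (X Y : lmodType R) (A : X -> Y) n (x : X) :
  (forall x y, A (x + y) = A x + A y) -> A (n%:R *: x) = n%:R *: A x.
Proof.
move=> A_add; rewrite !scaler_nat; elim: n => [|n IH].
  by rewrite !mulr0n; apply: (addrI (A 0)); rewrite -A_add !addr0.
by rewrite !mulrS A_add IH.
Qed.

(** Multiplying by q reduces to natural scalars. This carries [A] through the rescalings by r/s and
    t/s. *)
Lemma additive_ratioZ (R : realType) (X Y : lmodType R) (A : X -> Y) p q
    (x : X) : (0 < q)%N ->
  (forall x y, A (x + y) = A x + A y) ->
  A ((p%:R / q%:R) *: x) = (p%:R / q%:R) *: A x.
Proof.
move=> q_gt0 A_add; have q_neq0 : q%:R != 0 :> R by rewrite pnatr_eq0 -lt0n.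
apply: (scalerI q_neq0); rewrite -additive_natZ// !scalerA.
by rewrite mulrCA mulfV// mulr1 additive_natZ.
Qed.

(** Transfers an estimate on [F] to [G] or [H]: since A(2x) = 2 A x, the triangle inequality through
    F(2x) bounds twice the distance. *)
Lemma dist_half (R : realType) (X : lmodType R) (Y : normedModType R)
    (F K A : X -> Y) (c d : R) (x : X) :
  (forall x y, A (x + y) = A x + A y) ->
  `|F (2 *: x) - 2 *: K x| <= c -> `|F (2 *: x) - A (2 *: x)| <= d ->
  `|K x - A x| <= (c + d) / 2.
Proof.
move=> A_add FK FA; rewrite ler_pdivlMr// mulrC.
have := lerD FK FA; apply: le_trans.
rewrite -[X in X * _]ger0_norm// -normrZ scalerBr -(additive_natZ 2 x A_add).
by rewrite [X in _ <= X + _]distrC ler_distD.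
Qed.

(** The uniqueness argument: A(3^n x) = 3^n A x, so the n-th distance to [A x] is at most 3^-n
    phi_tilde(3^n x, 3^n x), a vanishing tail. *)
Lemma stability_limit (R : realType) (X : lmodType R) (Y : normedModType R)
    (F A : X -> Y) (phi : X -> X -> R)
    (phi_ge0 : forall x y : X, x != 0 -> y != 0 -> 0 <= phi x y)
    (phi_fin : forall x y : X, x != 0 -> y != 0 ->
       (phi_tilde phi x y < +oo)%E)
    (A_add : forall x y, A (x + y) = A x + A y)
    (FA : forall x, x != 0 -> (`|F x - A x|%:E <= phi_tilde phi x x)%E) (x : X) :
  x != 0 -> 3 ^- n *: F (3 ^+ n *: x) @[n --> \oo] --> A x.
Proof.
move=> x0.
pose e n := ((3 ^- n)%:E * phi_tilde phi (3 ^+ n *: x) (3 ^+ n *: x))%E.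
have e_cvg0 : e @ \oo --> (0 : \bar R)%E.
  exact: phi_tilde_tail_cvg (phi_fin _ _ x0 x0).
have A3 n : A (3 ^+ n *: x) = 3 ^+ n *: A x by rewrite -natrX additive_natZ.
have e_fin n : e n \is a fin_num.
  rewrite fin_numM// ge0_fin_numE ?phi_fin ?expr3Z_neq0//.
  exact: le_trans (FA _ (expr3Z_neq0 n x0)).
apply: (@cvg_dist_squeeze _ _ _ (cst (A x)) (fun n => fine (e n))).
- move=> n; rewrite -lee_fin fineK//.
  have -> : 3 ^- n *: F (3 ^+ n *: x) - A x =
      3 ^- n *: (F (3 ^+ n *: x) - A (3 ^+ n *: x)).
    by rewrite A3 scalerBr [in X in _ = _ - X]scalerA mulVf ?scale1r.
  rewrite normrZ ger0_norm ?invr_ge0 ?exprn_ge0// EFinM.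
  by rewrite lee_wpmul2l ?lee_fin ?invr_ge0 ?exprn_ge0// FA// expr3Z_neq0.
- exact: (fine_cvg e_cvg0).
- exact: cvg_cst.
Qed.

(** * Existence for the rescaled inequality *)

(** Hyers' direct method: [pexider_triple] at 3^n x, divided by 3^n, bounds the n-th step of [D x]
    by the n-th term of phi_tilde(x, x). *)
Lemma pexider_stability (R : realType) (X : lmodType R)
    (Y : completeNormedModType R) (F G H : X -> Y) (phi : X -> X -> R)
    (F0 : F 0 = 0) (H_odd : forall x, H (- x) = - H x)
    (phi_ge0 : forall x y : X, x != 0 -> y != 0 -> 0 <= phi x y)
    (phi_fin : forall x y : X, x != 0 -> y != 0 ->
       (phi_tilde phi x y < +oo)%E)
    (FGH : forall x y, x != 0 -> y != 0 ->
       `|F (x + y) - G x - H y| <= phi x y) :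
  exists A : X -> Y, (forall x y, A (x + y) = A x + A y) /\
    (forall x, x != 0 -> (`|F x - A x|%:E <= phi_tilde phi x x)%E).
Proof.
pose D x n := 3 ^- n *: F (3 ^+ n *: x).
have D_lim x : x != 0 -> cvgn (D x) /\
    (`|F x - limn (D x)|%:E <= phi_tilde phi x x)%E.
  move=> x0; have := phi_fin _ _ x0 x0; rewrite phi_tildeE// => sum_fin.
  have -> : F x = D x 0%N by rewrite /D expr0 invr1 !scale1r.
  apply: cvg_summable_steps => // n.
  have := pexider_triple F0 H_odd FGH (expr3Z_neq0 n x0).
  rewrite -(ler_pM2l (x := 3 ^- n)) ?invr_gt0 ?exprn_gt0// mulrCA.
  rewrite -[X in X * _]ger0_norm ?invr_ge0 ?exprn_ge0// -normrZ scalerBr.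
  by rewrite /D !scalerA -invfM -exprS -exprSr.
exists (fun x => limn (D x)); split; last by move=> x /D_lim[].
apply: (pexider_limit_additive F0 H_odd FGH) => [x y|x].
  exact: phi_expr3_cvg0.
(* At 0 no estimate is available, but [D 0] is constantly 0 because F 0 = 0. *)
have [->|/D_lim[]//] := eqVneq x 0.
rewrite (_ : D 0 = cst 0) ?lim_cst//; last first.
  by apply/funext => n; rewrite /D scaler0 F0 scaler0.
rewrite [X in X @ _ --> _](_ : _ = cst 0); first exact: cvg_cst.
by apply/funext => n; rewrite scaler0 F0 scaler0.
Qed.

Local Close Scope classical_set_scope.

(** * Return to the original mappings *)

Theorem proposition4p1 (R : realType) (X : lmodType R)
    (Y : completeNormedModType R) (r s t : nat)
    (r_gt0 : (0 < r)%N) (s_gt0 : (0 < s)%N) (t_gt0 : (0 < t)%N)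
    (f g h : X -> Y) (f0 : f 0 = 0) (g0 : g 0 = 0) (h0 : h 0 = 0)
    (phi : X -> X -> R)
    (phi_ge0 : forall x y : X, x != 0 -> y != 0 -> 0 <= phi x y)
    (phi_tilde_fin : forall x y : X, x != 0 -> y != 0 ->
       (phi_tilde phi x y < +oo)%E)
    (fgh_le : forall x y : X, x != 0 -> y != 0 ->
       `|r%:R *: f (r%:R^-1 *: (s%:R *: x + t%:R *: y))
         - s%:R *: g x - t%:R *: h y|
       <= phi x ((t%:R / s%:R) *: y))
    (h_odd : forall x : X, h (- x) = - h x) :
  exists! A : X -> Y,
    (forall x y : X, A (x + y) = A x + A y) /\
    (forall x : X, x != 0 ->
      [/\ (`|f x - A x|%:E <=
            (1 / r%:R)%:E *
              phi_tilde phi ((r%:R / s%:R) *: x) ((r%:R / s%:R) *: x))%E,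
          (`|g x - A x|%:E <=
            (1 / (2 * s%:R) * phi x x)%:E
            + (1 / (2 * s%:R) * phi x (- x))%:E
            + (1 / (2 * s%:R))%:E * phi_tilde phi (2 *: x) (2 *: x))%E
        & (`|h x - A x|%:E <=
            (1 / (2 * t%:R) *
              phi ((t%:R / s%:R) *: x) ((t%:R / s%:R) *: x))%:E
            + (1 / (2 * t%:R) *
              phi ((t%:R / s%:R) *: x) ((- t%:R / s%:R) *: x))%:E
            + (1 / (2 * t%:R))%:E *
              phi_tilde phi ((2 * t%:R / s%:R) *: x)
                            ((2 * t%:R / s%:R) *: x))%E]).
Proof.

have rn0 : r%:R != 0 :> R by rewrite pnatr_eq0 -lt0n.
have sn0 : s%:R != 0 :> R by rewrite pnatr_eq0 -lt0n.
have tn0 : t%:R != 0 :> R by rewrite pnatr_eq0 -lt0n.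
have rp : 0 < r%:R :> R by rewrite ltr0n.
have sp : 0 < s%:R :> R by rewrite ltr0n.
have tp : 0 < t%:R :> R by rewrite ltr0n.
have ratio_neq0 (m n : nat) (x : X) : (0 < m)%N -> (0 < n)%N -> x != 0 ->
    (m%:R / n%:R) *: x != 0.
  move=> m0 n0 x0; rewrite scaler_eq0 negb_or x0 andbT.
  by rewrite mulf_neq0 ?invr_neq0// pnatr_eq0 -lt0n.
have ratioK (m n : nat) (x : X) : (0 < m)%N -> (0 < n)%N ->
    (m%:R / n%:R) *: ((n%:R / m%:R) *: x) = x.
  by move=> m0 n0; rewrite scalerA mulrA divfK ?mulfV ?scale1r ?pnatr_eq0 -?lt0n.
pose F z := r%:R *: f ((s%:R / r%:R) *: z).
pose G z := s%:R *: g z.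
pose H z := t%:R *: h ((s%:R / t%:R) *: z).
have F0 : F 0 = 0 by rewrite /F scaler0 f0 scaler0.
have H_odd x : H (- x) = - H x by rewrite /H scalerN h_odd scalerN.
(* The hypothesis at x and (s/t) y: the argument of [f] becomes (s/r)(x + y), and t/s cancels inside
   [phi]. *)
have FGH x y : x != 0 -> y != 0 -> `|F (x + y) - G x - H y| <= phi x y.
  move=> x0 y0; have := fgh_le _ _ x0 (ratio_neq0 _ _ _ s_gt0 t_gt0 y0).
  rewrite ratioK// /F /G /H; congr (`|_ *: f _ - _ - _| <= _).
  by rewrite !scalerDr !scalerA; congr (_ *: _ + _ *: _); field;
    rewrite ?rn0 ?tn0.
have FA_fA (A : X -> Y) x : (forall x y, A (x + y) = A x + A y) ->
    `|F ((r%:R / s%:R) *: x) - s%:R *: A ((r%:R / s%:R) *: x)| =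
    r%:R * `|f x - A x|.
  move=> A_add; rewrite /F ratioK// additive_ratioZ// scalerA mulrCA mulfV//.
  by rewrite mulr1 -scalerBr normrZ ger0_norm.
have tilde_fin x : x != 0 -> exists P : R, phi_tilde phi x x = P%:E.
  move=> x0; exists (fine (phi_tilde phi x x)); rewrite fineK//.
  by rewrite ge0_fin_numE ?phi_tilde_fin// phi_tilde_ge0.
have two_neq0 (x : X) : x != 0 -> 2 *: x != 0.
  by move=> x0; rewrite scaler_eq0 negb_or pnatr_eq0.
(* The bound on [f] at (s/r) x says that s A is within phi_tilde(x, x) of [F] at x, so
   [stability_limit] identifies s A. *)
have F_lim (A : X -> Y) : (forall x y, A (x + y) = A x + A y) ->
    (forall x, x != 0 -> (`|f x - A x|%:E <= (1 / r%:R)%:E *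
      phi_tilde phi ((r%:R / s%:R) *: x) ((r%:R / s%:R) *: x))%E) ->
    forall x, x != 0 ->
      (3 ^- n *: F (3 ^+ n *: x) @[n --> \oo] --> s%:R *: A x)%classic.
  move=> A_add fA; apply: stability_limit (phi_ge0) phi_tilde_fin _ _.
    by move=> x y; rewrite A_add scalerDr.
  move=> x x0; have /fA := ratio_neq0 _ _ _ s_gt0 r_gt0 x0.
  have := FA_fA A ((s%:R / r%:R) *: x) A_add; rewrite !ratioK// => ->.
  have [P ->] := tilde_fin _ x0.
  by rewrite -EFinM !lee_fin mul1r ler_pdivlMl.
have [A' [A'_add FA']] := pexider_stability F0 H_odd phi_ge0 phi_tilde_fin FGH.
(* If [f] is close to an additive [A], then F z = r f((s/r) z) is close to s A z; hence the division
   by s. *)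
pose A x := s%:R^-1 *: A' x.
have sA x : s%:R *: A x = A' x by rewrite scalerA mulfV ?scale1r.
have A_add x y : A (x + y) = A x + A y by rewrite /A A'_add scalerDr.
have fA x : x != 0 -> (`|f x - A x|%:E <= (1 / r%:R)%:E *
    phi_tilde phi ((r%:R / s%:R) *: x) ((r%:R / s%:R) *: x))%E.
  move=> x0; have z0 := ratio_neq0 _ _ _ r_gt0 s_gt0 x0.
  have := FA' _ z0; rewrite -sA FA_fA//; have [P ->] := tilde_fin _ z0.
  by rewrite -EFinM !lee_fin mul1r ler_pdivlMl.
exists A; split; last first.
  move=> A2 [A2_add A2_le]; apply/funext => x.
  (* The bounds say nothing at 0, where additivity forces the value 0. *)
  have [->|x0] := eqVneq x 0.
    have additive0 (B : X -> Y) : (forall x y, B (x + y) = B x + B y) -> B 0 = 0.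
      by move/(additive_natZ 0 0); rewrite !scale0r.
    by rewrite !additive0.
  have f_A2 y : y != 0 -> (`|f y - A2 y|%:E <= (1 / r%:R)%:E *
      phi_tilde phi ((r%:R / s%:R) *: y) ((r%:R / s%:R) *: y))%E.
    by move=> y0; have [] := A2_le y y0.
  apply: (scalerI sn0); have lim_A := F_lim _ A_add fA _ x0.
  exact: (cvg_unique (@norm_hausdorff _ _) lim_A (F_lim _ A2_add f_A2 _ x0)).
split=> // x x0; split; first exact: fA.
- have [P eP] := tilde_fin _ (two_neq0 _ x0).
  have := FA' _ (two_neq0 _ x0); rewrite eP lee_fin => FA2.
  have := dist_half A'_add (pexider_double_l F0 H_odd FGH x0) FA2.
  rewrite -sA /G -scalerBr normrZ ger0_norm//.
  rewrite -!EFinM -!EFinD lee_fin invfM => le.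
  by rewrite -(ler_pM2l sp) (le_trans le)// le_eqVlt; apply/orP; left;
    apply/eqP; field.
(* At this point H z = t h x and A' z = t A x, so the half-distance bound for [H] becomes one for
   [h] after division by t. *)
- pose z := (t%:R / s%:R) *: x.
  have z0 : z != 0 := ratio_neq0 _ _ _ t_gt0 s_gt0 x0.
  rewrite -[(2 * t%:R / s%:R) *: x](_ : 2 *: z = _); last first.
    by rewrite /z scalerA mulrA.
  rewrite mulNr scaleNr -/z.
  have [P eP] := tilde_fin _ (two_neq0 _ z0); rewrite eP.
  have := FA' _ (two_neq0 _ z0); rewrite eP lee_fin => FA2.
  have := dist_half A'_add (pexider_double_r F0 H_odd FGH z0) FA2.
  rewrite -sA /H /z ratioK// (additive_ratioZ t x s_gt0 A_add).
  rewrite scalerA mulrCA mulfV// mulr1.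
  rewrite -scalerBr normrZ ger0_norm// -/z.
  rewrite -!EFinM -!EFinD lee_fin invfM => le.
  by rewrite -(ler_pM2l tp) (le_trans le)// le_eqVlt; apply/orP; left;
    apply/eqP; field.
Qed.
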